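(* Let $n=4k+1$ be a positive integer. Let $R(x,y,t,z)=(4xyz-1)(3+4t)-4x^2y$, so that $R(x,1,t,z)=(4xz-1)(3+4t)-4x^2$. The following are equivalent: (i) there exist positive integers $x_0,z_0$ and an integer $t_0\ge0$ with $n=R(x_0,1,t_0,z_0)$; (ii) there exist positive integers $d,m$ with $-n\equiv 4d^2\pmod{4dm-1}$; (iii) there exist positive integers $u,v,w$ with $\frac4n=\frac{1}{uv}+\frac{1}{uwn}+\frac{1}{vwn}$; (iv) there exist an integer $t\ge 0$ and positive integers $a,b$ with $ab=k+1+t$ and $3+4t\mid a+b$. *)

(* Defs.v *)
From mathcomp Require Import all_boot all_order all_algebra.
Import Order.TTheory GRing.Theory Num.Theory.
Local Open Scope ring_scope.

Definition R (x y t z : int) : int :=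
  (4 * x * y * z - 1) * (3 + 4 * t) - 4 * x ^+ 2 * y.

(* Main.v *)
Require Import Defs.
From mathcomp Require Import all_boot all_order all_algebra.
From mathcomp Require Import ring zify.
Import Order.TTheory GRing.Theory Num.Theory.
Local Open Scope ring_scope.

(** Clearing denominators, (iii) says [u + v = w q] with [q = 4 u v - n].
    Eliminating [v = w q - u] turns this into [n + 4 u^2 = (4 u w - 1) q],
    which is (i) and (ii) with [x = d = u] and [z = m = w]; since [n] is
    [1] modulo [4], the positive integer [q] is automatically of the form
    [3 + 4 t], which gives the parameter [t] of (i) and (iv). *)

(** Over [rat], the right side minus [4 / n] equals [u + v - w * (4 * u * v - n)] divided by the
    nonzero [u * v * w * n]. *)
Lemma egyptian_fractionE (n u v w : int) :
  0 < n -> 0 < u -> 0 < v -> 0 < w ->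
  4 / n%:Q = 1 / (u * v)%:Q + 1 / (u * w * n)%:Q + 1 / (v * w * n)%:Q
  <-> u + v = w * (4 * u * v - n).
Proof.
move=> n0 u0 v0 w0; rewrite !rmorphM /=.
have nz (x : int) : 0 < x -> x%:Q != 0 by move=> x0; rewrite intr_eq0 gt_eqF.
move: (nz _ n0) (nz _ u0) (nz _ v0) (nz _ w0) => n1 u1 v1 w1.
have -> : u + v = w * (4 * u * v - n) <->
    u%:Q + v%:Q = w%:Q * (4 * u%:Q * v%:Q - n%:Q).
  by split=> [/(congr1 (intr : int -> rat))|e]; last apply: (@intr_inj rat);
    rewrite !(rmorphM, rmorphD, rmorphN) /=.
set U := u%:Q in u1 *; set V := v%:Q in v1 *.
set W := w%:Q in w1 *; set N := n%:Q in n1 *.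
have -> : 1 / (U * V) + 1 / (U * W * N) + 1 / (V * W * N)
    = 4 / N + (U + V - W * (4 * U * V - N)) / (U * V * W * N).
  by field; rewrite n1 u1 v1 w1.
split=> [/esym/eqP|->]; last by rewrite subrr mul0r addr0.
rewrite -subr_eq0 addrAC subrr add0r mulf_eq0 invr_eq0 !mulf_eq0.
rewrite (negPf n1) (negPf u1) (negPf v1) (negPf w1) !orbF.
by rewrite subr_eq0 => /eqP.
Qed.

Theorem theorem9 (n k : int) (n_gt0 : 0 < n) (nE : n = 4 * k + 1) :
  [<-> exists x0 z0 t0 : int,
         [/\ 0 < x0, 0 < z0, 0 <= t0 & n = R x0 1 t0 z0];
       exists d m : int,
         [/\ 0 < d, 0 < m & (- n = 4 * d ^+ 2 %[mod 4 * d * m - 1])%Z];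
       exists u v w : int,
         [/\ 0 < u, 0 < v, 0 < w &
             4 / n%:Q = 1 / (u * v)%:Q + 1 / (u * w * n)%:Q
                        + 1 / (v * w * n)%:Q];
       exists t a b : int,
         [/\ 0 <= t, 0 < a, 0 < b, a * b = k + 1 + t
           & (3 + 4 * t %| a + b)%Z]].
Proof.
tfae.
- move=> [x [z [t [x0 z0 t0 nR]]]]; exists x, z; split=> //.
  apply/eqP; rewrite eqz_mod_dvd; apply/dvdzP; exists (- (3 + 4 * t)).
  by rewrite nR /R; ring.
(* Flipping the congruence gives the quotient [q] of [4 * d ^+ 2 + n], which is positive. *)
- move=> [d [m [d0 m0 /esym/eqP]]]; rewrite eqz_mod_dvd => /dvdzP[q qE].
  have dm0 : 0 < 4 * d * m - 1 by nia.
  have q0 : 0 < q.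
    by rewrite -(pmulr_lgt0 _ dm0) -qE opprK; nia.
  (* With [u = d], [w = m], the choice [v = m * q - d] forces [u + v = w * q]; this identity says
     that [q] is [4 * u * v - n]. *)
  have dvE : 4 * d * (m * q - d) = n + q by nia.
  have v0 : 0 < m * q - d by nia.
  exists d, (m * q - d), m; split=> //; apply/egyptian_fractionE => //.
  by rewrite dvE; ring.
- move=> [u [v [w [u0 v0 w0 /egyptian_fractionE-/(_ n_gt0 u0 v0 w0) e]]]].
  have q0 : 0 < 4 * u * v - n by rewrite -(pmulr_rgt0 _ w0) -e addr_gt0.
  (* This [t] solves [3 + 4 * t = 4 * u * v - n]; the right side is positive and 3 modulo 4, hence
     at least 3. *)
  exists (u * v - k - 1), u, v; split=> //; [lia|ring|].
  by apply/dvdzP; exists w; rewrite e nE; ring.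
- move=> [t [a [b [t0 a0 b0 abE /dvdzP[w wE]]]]].
  have q0 : 0 < 3 + 4 * t by lia.
  have w0 : 0 < w by rewrite -(pmulr_lgt0 _ q0) -wE addr_gt0.
  (* The cofactor [w] of [3 + 4 * t] in [a + b] serves as [z0], and [b] is then eliminated. *)
  exists a, w, t; split=> //.
  have -> : n = 4 * (a * b) - (3 + 4 * t) by rewrite abE nE; ring.
  have -> : b = w * (3 + 4 * t) - a by rewrite -wE; ring.
  by rewrite /R; ring.
Qed.
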